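(* Let $r_1>0$ and $A_j,B_j\in\mathbb{C}$ for $j\in\mathbb{N}$. Suppose that $$H_0(r)\sum_{j=0}^{\infty}\frac{A_j}{r^j}+H_1(r)\sum_{j=0}^{\infty}\frac{B_j}{r^j}=0\quad\text{for all } r\ge r_1,$$ where both series converge absolutely and uniformly for $r\ge r_1$. Then $A_j=B_j=0$ for all $j\in\mathbb{N}$.
   Context: $\mathbb{N}$ includes $0$. $H_0$ and $H_1$ are the Hankel functions of the first kind of orders zero and one. *)

(* Defs.v *)
(* Stdlib world: the classical reals with Coquelicot. *)
From Stdlib Require Import Reals Factorial.
From Coquelicot Require Import Coquelicot.

Open Scope R_scope.

Definition harmonic (n : nat) : R := sum_n_m (fun m => / INR m) 1 n.

Definition euler_gamma : R :=
  real (Lim_seq (fun n => harmonic n - ln (INR n))).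

Definition bessel_J (n : nat) (x : R) : R :=
  Series (fun k => (-1) ^ k / (INR (fact k) * INR (fact (n + k)))
                   * (x / 2) ^ (n + 2 * k)).

(* For x > 0, the term of index p is (n - 1 - p)! / p! * (2 / x) ^ (n - 2 p),
   for p = 0, ..., n - 1; the exponent n - 2 p may be negative. *)
Definition bessel_Y_polar (n : nat) (x : R) : R :=
  match n with
  | O => 0
  | S m => sum_n (fun p => INR (fact (m - p)) / INR (fact p)
                           * ((x / 2) ^ (2 * p) / (x / 2) ^ n)) m
  end.

(* Bessel function of the second kind (Neumann function) of integer order, on
   x > 0, with the digamma values psi (k + 1) = - gamma + harmonic k. *)
Definition bessel_Y (n : nat) (x : R) : R :=
  2 / PI * (ln (x / 2) + euler_gamma) * bessel_J n x
  - 1 / PI * bessel_Y_polar n x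
  - 1 / PI * Series (fun k => (-1) ^ k / (INR (fact k) * INR (fact (n + k)))
                              * (harmonic k + harmonic (n + k))
                              * (x / 2) ^ (n + 2 * k)).

Definition hankel1 (n : nat) (x : R) : C :=
  (RtoC (bessel_J n x) + Ci * RtoC (bessel_Y n x))%C.

(* Like Series, meaningful only for convergent series. *)
Definition CSeries (a : nat -> C) : C :=
  (Series (fun j => Re (a j)), Series (fun j => Im (a j))).

Definition Cseries_cv_abs_on (D : R -> Prop) (a : nat -> R -> C) : Prop :=
  forall r : R, D r -> ex_series (fun j => Cmod (a j r)).

Definition Cseries_cv_unif_on (D : R -> Prop) (a : nat -> R -> C) : Prop :=
  forall eps : posreal, eventually (fun n => forall r : R, D r ->
    Cmod (sum_n (fun j => a j r) n - CSeries (fun j => a j r))%C < eps).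

(* Main.v *)
Require Import Defs.
From Stdlib Require Import Reals Lra Lia Factorial Wf_nat.
From Coquelicot Require Import Coquelicot.

Open Scope R_scope.

(** Write [H0], [H1] for the two Hankel functions and [f], [g] for the sums of
    the series of coefficients [A], [B], so that [H0 f + H1 g = 0]. In the
    variable [t = 1/r] both [f] and [g] are power series of positive radius, and
    the point is that the ratio [H1 / H0] is not such a series: its expansion
    at infinity exists only as a divergent asymptotic series.

    If [f] and [g] vanish at [t = 0], dividing both by [t] preserves the relation,
    so by induction it is enough to show that the leading coefficients are zero
    ([hankel_leading_coeff_1], [hankel_leading_coeff_0]).

    Suppose [B 0 <> 0]. Then [w = f / g] is again a convergent power series [c]
    in [t] ([ratio_expansion]) and [H1 = - w H0]. From [H0' = - H1] and
    [H1' = H0 - H1 / r], and since [H0] and [H1] have no common zero, [w] solves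
    the Riccati equation [w' = - (1 + w^2 + w / r)] ([ratio_Riccati]). Comparing
    coefficients gives [c_0^2 = -1] and a quadratic recurrence for [c_k]. After
    the rotation [d_k = c_0^(k+1) c_k], which does not change the modulus, it reads
    [2 d_(k+1) = sum_(1 <= i <= k) d_i d_(k+1-i) + (k - 1) d_k] for
    [k >= 1], with [d_1 = 1/2]. Every term is nonnegative, so there is no
    cancellation, [d_(k+1) >= (k - 1)/2 * d_k], and [|c_k|] grows like a
    factorial, against the positive radius of convergence ([Riccati_divergent]).

    If [B 0 = 0 <> A 0], the inverse ratio [u = g / f] solves
    [u' = 1 + u^2 + u / r], whose constant coefficient gives [u_0^2 = -1], while
    [u_0 = B 0 / A 0 = 0].

    The differential relations between [H0] and [H1] come from term-by-term
    differentiation of the defining series. A common zero of [H0] and [H1] would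
    be one of [J_0] and [J_1], their real parts; this is excluded because
    [x^2 (J_0^2 + J_1^2)] is nondecreasing and [J_0 (0) = 1]. *)

(** * Power series near zero *)

Lemma CV_radius_geometric (a : nat -> R) (M rho x : R) :
  0 < rho -> (forall k, Rabs (a k) <= M * rho ^ k) -> Rabs x * rho < 1 ->
  Rbar_lt (Rabs x) (CV_radius a).
Proof.
  intros Hrho Ha Hx.
  apply Rbar_lt_le_trans with (/ rho).
  - simpl. apply Rmult_lt_reg_r with rho; [easy|]. rewrite Rinv_l; lra.
  - apply (proj1 (CV_radius_bounded a)). exists M. intro k.
    rewrite Rabs_mult, <- RPow_abs, Rabs_inv, (Rabs_pos_eq rho) by lra.
    rewrite pow_inv.
    apply Rmult_le_reg_r with (rho ^ k); [now apply pow_lt|].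
    rewrite Rmult_assoc, Rinv_l, Rmult_1_r; [apply Ha|].
    apply pow_nonzero; lra.
Qed.

(** The contrapositive of divergence outside the disk: convergence at [t] makes
    the terms tend to zero there. *)
Lemma ex_pseries_CV_radius_lt (a : nat -> R) (t x : R) :
  ex_pseries a t -> Rabs x < Rabs t -> Rbar_lt (Rabs x) (CV_radius a).
Proof.
  intros Ha Hx. apply Rbar_lt_le_trans with (Rabs t); [exact Hx|].
  apply Rbar_not_lt_le. intro H. apply CV_disk_outside in H. apply H.
  apply ex_series_lim_0. destruct Ha as [l Hl]. exists l.
  apply is_series_ext with (2 := Hl). intro n. rewrite pow_n_pow.
  unfold scal; simpl; unfold mult; simpl. ring.
Qed.

Lemma PSeries_nonzero_near_0 (a : nat -> R) :
  Rbar_lt 0 (CV_radius a) -> a 0%nat <> 0 ->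
  exists e : posreal, forall t, Rabs t < e -> PSeries a t <> 0.
Proof.
  intros Ha E.
  assert (Hc : continuity_pt (PSeries a) 0).
  { apply PSeries_continuity. now rewrite Rabs_R0. }
  apply continuity_pt_filterlim in Hc.
  destruct (proj1 (filterlim_locally _ _) Hc (mkposreal _ (Rabs_pos_lt _ E)))
    as [e He].
  exists e. intros t Ht H0.
  assert (B : Rabs (PSeries a t - PSeries a 0) < Rabs (a 0%nat)).
  { apply He. change (Rabs (t - 0) < e). now rewrite Rminus_0_r. }
  rewrite PSeries_0, H0, Rminus_0_l, Rabs_Ropp in B. lra.
Qed.

(** A one-sided identity principle is what is available for expansions at
    infinity: only [t = 1/r > 0] is meaningful. *)
Lemma PSeries_zero_right_nbhs_0 (a : nat -> R) (d : R) :
  0 < d -> (forall t, 0 < t < d -> is_pseries a t 0) -> a 0%nat = 0.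
Proof.
  intros Hd H.
  destruct (Req_dec (a 0%nat) 0) as [E|E]; [exact E|exfalso].
  destruct (PSeries_nonzero_near_0 a) as [e He]; [|exact E|].
  { rewrite <- Rabs_R0. apply ex_pseries_CV_radius_lt with (d / 2).
    - exists 0. apply H. lra.
    - rewrite Rabs_R0. apply Rabs_pos_lt. lra. }
  assert (He0 := cond_pos e).
  set (t := Rmin (e / 2) (d / 2)).
  assert (Ht : 0 < t /\ t <= e / 2 /\ t <= d / 2).
  { unfold t. split; [apply Rmin_pos; lra|]. split; [apply Rmin_l|apply Rmin_r]. }
  apply (He t); [rewrite Rabs_pos_eq; lra|].
  apply is_pseries_unique, H. lra.
Qed.

(** Once the constant coefficient is zero, division by [t] yields a power series
    that vanishes on the same interval, so the argument repeats. *)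
Lemma PSeries_zero_right_nbhs (a : nat -> R) (d : R) :
  0 < d -> (forall t, 0 < t < d -> is_pseries a t 0) -> forall n, a n = 0.
Proof.
  intros Hd H n. revert a H. induction n as [|n IH]; intros a H.
  - now apply PSeries_zero_right_nbhs_0 with d.
  - apply (IH (PS_decr_1 a)). intros t Ht.
    assert (H0 : a 0%nat = 0) by now apply PSeries_zero_right_nbhs_0 with d.
    assert (E := is_pseries_decr_1 a t (/ t) 0).
    assert (E' : is_pseries (PS_decr_1 a) t (scal (/ t) (plus 0 (opp (a 0%nat))))).
    { apply E; [|now apply H]. unfold mult, one; simpl. apply Rinv_l. lra. }
    rewrite H0 in E'.
    replace (scal (/ t) (plus 0 (opp 0))) with 0 in E'; [exact E'|].
    unfold scal, plus, opp; simpl; unfold mult; simpl. ring.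
Qed.

Lemma Re_RtoC_mult (x : R) (z : C) : Re (RtoC x * z) = x * Re z.
Proof. unfold Re; simpl; ring. Qed.

Lemma Im_RtoC_mult (x : R) (z : C) : Im (RtoC x * z) = x * Im z.
Proof. unfold Im; simpl; ring. Qed.

(** * Power series with complex coefficients *)

(** Complex coefficients but a real variable, handled by components as in
    [CSeries]; the real theory of power series then applies to each part. *)
Definition is_Cpseries (a : nat -> C) (t : R) (l : C) : Prop :=
  is_pseries (fun k => Re (a k)) t (Re l) /\
  is_pseries (fun k => Im (a k)) t (Im l).

Definition CPSeries (a : nat -> C) (t : R) : C :=
  (PSeries (fun k => Re (a k)) t, PSeries (fun k => Im (a k)) t).

(** Positive radius of convergence, with explicit constants: unlike a bare radius,
    the bound can be propagated through the recursion that defines a quotient. *)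
Definition Cgeometric (M rho : R) (a : nat -> C) : Prop :=
  0 < rho /\ forall k, Cmod (a k) <= M * rho ^ k.

Lemma Im_le_Cmod (z : C) : Rabs (Im z) <= Cmod z.
Proof. eapply Rle_trans; [apply Rmax_r|apply Rmax_Cmod]. Qed.

Lemma Cgeometric_radius (M rho t : R) (a : nat -> C) :
  Cgeometric M rho a -> Rabs t * rho < 1 ->
  Rbar_lt (Rabs t) (CV_radius (fun k => Re (a k))) /\
  Rbar_lt (Rabs t) (CV_radius (fun k => Im (a k))).
Proof.
  intros [Hr Ha] Ht; split; apply CV_radius_geometric with M rho; auto; intro k;
    eapply Rle_trans; [apply re_le_Cmod|apply Ha|apply Im_le_Cmod|apply Ha].
Qed.

Lemma CPSeries_correct (M rho t : R) (a : nat -> C) :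
  Cgeometric M rho a -> Rabs t * rho < 1 -> is_Cpseries a t (CPSeries a t).
Proof.
  intros Ha Ht. destruct (Cgeometric_radius _ _ _ _ Ha Ht) as [H1 H2].
  split; apply PSeries_correct; now apply CV_radius_inside.
Qed.

Lemma is_Cpseries_unique (a : nat -> C) (t : R) (l : C) :
  is_Cpseries a t l -> CPSeries a t = l.
Proof.
  intros [H1 H2]. unfold CPSeries.
  rewrite (is_pseries_unique _ _ _ H1), (is_pseries_unique _ _ _ H2).
  now destruct l.
Qed.

Lemma is_Cpseries_zero (a : nat -> C) (d : R) :
  0 < d -> (forall t, 0 < t < d -> is_Cpseries a t 0) ->
  forall n, a n = RtoC 0.
Proof.
  intros Hd H n.
  assert (H1 := PSeries_zero_right_nbhs (fun k => Re (a k)) d Hd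
                  (fun t Ht => proj1 (H t Ht)) n).
  assert (H2 := PSeries_zero_right_nbhs (fun k => Im (a k)) d Hd
                  (fun t Ht => proj2 (H t Ht)) n).
  cbv beta in H1, H2. destruct (a n) as [x y]. simpl in *. now subst.
Qed.

Lemma is_Cpseries_plus (a b : nat -> C) (t : R) (l m : C) :
  is_Cpseries a t l -> is_Cpseries b t m ->
  is_Cpseries (fun k => a k + b k)%C t (l + m)%C.
Proof.
  intros [H1 H2] [H3 H4]; split.
  - exact (is_pseries_plus _ _ _ _ _ H1 H3).
  - exact (is_pseries_plus _ _ _ _ _ H2 H4).
Qed.

Lemma is_Cpseries_scal (e : R) (a : nat -> C) (t : R) (l : C) :
  is_Cpseries a t l -> is_Cpseries (fun k => RtoC e * a k)%C t (RtoC e * l)%C.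
Proof.
  intros [H1 H2]; split.
  - rewrite Re_RtoC_mult.
    eapply is_pseries_ext; [intro; symmetry; apply Re_RtoC_mult|].
    apply (is_pseries_scal e _ t (Re l)); [|exact H1].
    apply Rmult_comm.
  - rewrite Im_RtoC_mult.
    eapply is_pseries_ext; [intro; symmetry; apply Im_RtoC_mult|].
    apply (is_pseries_scal e _ t (Im l)); [|exact H2].
    apply Rmult_comm.
Qed.

Definition CPS_shift (a : nat -> C) (n : nat) : C :=
  match n with O => RtoC 0 | S k => a k end.

Lemma is_Cpseries_shift (a : nat -> C) (t : R) (l : C) :
  is_Cpseries a t l -> is_Cpseries (CPS_shift a) t (RtoC t * l)%C.
Proof.
  intros [H1 H2]; split.
  - rewrite Re_RtoC_mult.
    eapply is_pseries_ext; [|exact (is_pseries_incr_1 (V := R_NormedModule) _ _ _ H1)].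
    now intros [|n].
  - rewrite Im_RtoC_mult.
    eapply is_pseries_ext; [|exact (is_pseries_incr_1 (V := R_NormedModule) _ _ _ H2)].
    now intros [|n].
Qed.

Definition CPS_one (n : nat) : C := match n with O => RtoC 1 | S _ => RtoC 0 end.

Lemma is_pseries_const (a : nat -> R) (t : R) :
  (forall n, a (S n) = 0) -> is_pseries a t (a 0%nat).
Proof.
  intro Ha. unfold is_pseries, is_series.
  apply filterlim_ext with (fun _ => a 0%nat); [|apply filterlim_const].
  induction x as [|n IH].
  - rewrite sum_O. symmetry. apply (Rmult_1_l (a 0%nat)).
  - rewrite sum_Sn, <- IH, Ha. symmetry.
    change (a 0%nat + pow_n t (S n) * 0 = a 0%nat). ring.
Qed.

Lemma is_Cpseries_one (t : R) : is_Cpseries CPS_one t 1.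
Proof.
  split; [apply (is_pseries_const (fun k => Re (CPS_one k)))
         |apply (is_pseries_const (fun k => Im (CPS_one k)))]; reflexivity.
Qed.

Definition CPS_mult (a b : nat -> C) (n : nat) : C :=
  sum_n (fun k => a k * b (n - k)%nat)%C n.

Lemma Re_sum_n (u : nat -> C) (n : nat) : Re (sum_n u n) = sum_n (fun k => Re (u k)) n.
Proof.
  induction n as [|n IH]; [now rewrite !sum_O|]. rewrite !sum_Sn, <- IH. reflexivity.
Qed.

Lemma Im_sum_n (u : nat -> C) (n : nat) : Im (sum_n u n) = sum_n (fun k => Im (u k)) n.
Proof.
  induction n as [|n IH]; [now rewrite !sum_O|]. rewrite !sum_Sn, <- IH. reflexivity.
Qed.

Lemma is_Cpseries_mult (a b : nat -> C) (M rho N sigma t : R) :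
  Cgeometric M rho a -> Cgeometric N sigma b -> Rabs t * rho < 1 -> Rabs t * sigma < 1 ->
  is_Cpseries (CPS_mult a b) t (CPSeries a t * CPSeries b t)%C.
Proof.
  intros Ha Hb Hr Hs.
  destruct (Cgeometric_radius _ _ _ _ Ha Hr) as [A1 A2].
  destruct (Cgeometric_radius _ _ _ _ Hb Hs) as [B1 B2].
  assert (P : forall u v, Rbar_lt (Rabs t) (CV_radius u) ->
    Rbar_lt (Rabs t) (CV_radius v) ->
    is_pseries (PS_mult u v) t (PSeries u t * PSeries v t)).
  { intros u v Hu Hv. rewrite <- PSeries_mult by assumption.
    apply PSeries_correct. now apply ex_pseries_mult. }
  split.
  - eapply is_pseries_ext;
      [|exact (is_pseries_minus _ _ _ _ _ (P _ _ A1 B1) (P _ _ A2 B2))].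
    intro n. unfold CPS_mult. rewrite Re_sum_n.
    unfold PS_minus, PS_plus, PS_opp, PS_mult. rewrite <- !sum_n_Reals.
    change (sum_n (fun k => Re (a k) * Re (b (n - k)%nat)) n
            - sum_n (fun k => Im (a k) * Im (b (n - k)%nat)) n
            = sum_n (fun k => Re (a k * b (n - k)%nat)%C) n).
    rewrite !sum_n_Reals, <- minus_sum. reflexivity.
  - replace (Im (CPSeries a t * CPSeries b t)%C)
      with (plus (PSeries (fun k => Re (a k)) t * PSeries (fun k => Im (b k)) t)
                 (PSeries (fun k => Im (a k)) t * PSeries (fun k => Re (b k)) t))
      by reflexivity.
    eapply is_pseries_ext;
      [|exact (is_pseries_plus _ _ _ _ _ (P _ _ A1 B2) (P _ _ A2 B1))].
    intro n. unfold CPS_mult. rewrite Im_sum_n.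
    unfold PS_plus, PS_mult.
    rewrite !sum_n_Reals, <- plus_sum. reflexivity.
Qed.

(** * Quotient of power series *)

(** Each coefficient of [f / g] depends on all the previous ones, so the recursion
    is on the function that is correct up to index [n]. *)
Fixpoint CPS_div_prefix (f g : nat -> C) (n : nat) : nat -> C :=
  match n with
  | O => fun _ => (f 0%nat / g 0%nat)%C
  | S m => fun k =>
      if Nat.leb k m then CPS_div_prefix f g m k
      else ((f n - sum_n (fun i => CPS_div_prefix f g m i * g (n - i)%nat) m) / g 0%nat)%C
  end.

Definition CPS_div (f g : nat -> C) (n : nat) : C := CPS_div_prefix f g n n.

Lemma CPS_div_prefix_eq (f g : nat -> C) (n k : nat) :
  (k <= n)%nat -> CPS_div_prefix f g n k = CPS_div f g k.
Proof.
  induction n as [|n IH]; intro H.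
  - now replace k with 0%nat by lia.
  - destruct (Nat.leb k n) eqn:E.
    + cbn -[Nat.sub]. rewrite E. apply IH. now apply Nat.leb_le.
    + apply Nat.leb_gt in E. now replace k with (S n) by lia.
Qed.

Lemma CPS_div_S (f g : nat -> C) (n : nat) :
  CPS_div f g (S n) =
  ((f (S n) - sum_n (fun i => CPS_div f g i * g (S n - i)%nat) n) / g 0%nat)%C.
Proof.
  unfold CPS_div at 1. cbn [CPS_div_prefix].
  rewrite (proj2 (Nat.leb_gt (S n) n)) by lia.
  rewrite (sum_n_ext_loc _ (fun i => CPS_div f g i * g (S n - i)%nat)%C n);
    [reflexivity|].
  intros k Hk. now rewrite CPS_div_prefix_eq.
Qed.

Lemma CPS_mult_CPS_div (f g : nat -> C) (n : nat) :
  g 0%nat <> RtoC 0 -> CPS_mult (CPS_div f g) g n = f n.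
Proof.
  intro g0.
  unfold CPS_mult. destruct n as [|n].
  - rewrite sum_O. unfold CPS_div; simpl. field. exact g0.
  - rewrite sum_Sn, Nat.sub_diag, CPS_div_S.
    change plus with Cplus. field. exact g0.
Qed.
Lemma Cmod_sum_n (u : nat -> C) (n : nat) :
  Cmod (sum_n u n) <= sum_n (fun k => Cmod (u k)) n.
Proof.
  induction n as [|n IH]; [rewrite !sum_O; lra|]. rewrite !sum_Sn.
  eapply Rle_trans; [apply Cmod_triangle|]. apply Rplus_le_compat_r, IH.
Qed.

(** The partial sums [S_n = 1 + e_0 + ... + e_n] satisfy
    [S_(n+1) <= (1 + m) S_n]. *)
Lemma discrete_Gronwall (e : nat -> R) (m : R) :
  0 <= m -> e 0%nat <= m ->
  (forall n, e (S n) <= m * (1 + sum_n e n)) ->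
  forall n, e n <= (1 + m) * (1 + m) ^ n.
Proof.
  intros Hm H0 HS.
  assert (S1 : forall n, 1 + sum_n e n <= (1 + m) * (1 + m) ^ n).
  { induction n as [|n IH]; [rewrite sum_O; simpl; lra|].
    rewrite sum_Sn. change plus with Rplus. cbn [pow]. specialize (HS n).
    assert (m * (1 + sum_n e n) <= m * ((1 + m) * (1 + m) ^ n))
      by (apply Rmult_le_compat_l; lra).
    simpl in *. lra. }
  intros [|n]; [simpl; lra|].
  apply Rle_trans with (1 := HS n).
  apply Rle_trans with (m * ((1 + m) * (1 + m) ^ n)).
  - apply Rmult_le_compat_l; auto.
  - cbn [pow]. assert (0 <= (1 + m) ^ n) by (apply pow_le; lra). nra.
Qed.

(** A power series with nonzero constant term has an inverse of positive radius.
    With [e_n = |c_n| / rho^n], the recursion for [c = f / g] bounds [e_(n+1)] by a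
    multiple of [1 + e_0 + ... + e_n]. *)
Lemma Cgeometric_CPS_div (f g : nat -> C) (M rho : R) :
  g 0%nat <> RtoC 0 -> Cgeometric M rho f -> Cgeometric M rho g ->
  exists N sigma, Cgeometric N sigma (CPS_div f g).
Proof.
  intros Hg0 [Hr Hf] [_ Hg].
  assert (G0 : 0 < Cmod (g 0%nat)) by now apply Cmod_gt_0.
  assert (HM : 0 <= M).
  { specialize (Hg 0%nat). simpl in Hg. lra. }
  set (m := M / Cmod (g 0%nat)).
  assert (Hm : 0 <= m) by (apply Rmult_le_pos; [lra|left; now apply Rinv_0_lt_compat]).
  set (e := fun n => Cmod (CPS_div f g n) / rho ^ n).
  assert (Hp : forall n, 0 < rho ^ n) by (intro; now apply pow_lt).
  assert (He : forall n, Cmod (CPS_div f g n) = e n * rho ^ n).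
  { intro n. unfold e. field. specialize (Hp n). lra. }
  assert (He0 : forall n, e n <= (1 + m) * (1 + m) ^ n).
  { apply discrete_Gronwall; [exact Hm| |].
    - unfold e, CPS_div. simpl. rewrite Cmod_div by exact Hg0.
      unfold m. specialize (Hf 0%nat). simpl in Hf.
      rewrite Rdiv_1_r. apply Rmult_le_compat_r; [|lra].
      left; now apply Rinv_0_lt_compat.
    - intro n. unfold e at 1. rewrite CPS_div_S, Cmod_div by exact Hg0.
      assert (HS : Cmod (sum_n (fun i => CPS_div f g i * g (S n - i)%nat)%C n)
                   <= M * rho ^ S n * sum_n e n).
      { eapply Rle_trans; [apply Cmod_sum_n|].
        rewrite !sum_n_Reals, scal_sum. apply sum_Rle. intros k Hk.
        rewrite Cmod_mult, He.
        replace (rho ^ S n) with (rho ^ k * rho ^ (S n - k))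
          by (rewrite <- pow_add; f_equal; lia).
        replace (e k * (M * (rho ^ k * rho ^ (S n - k))))
          with (e k * rho ^ k * (M * rho ^ (S n - k))) by ring.
        apply Rmult_le_compat_l; [|apply Hg].
        rewrite <- He. apply Cmod_ge_0. }
      assert (HT : Cmod (f (S n) - sum_n (fun i => CPS_div f g i * g (S n - i)%nat) n)%C
                   <= M * rho ^ S n * (1 + sum_n e n)).
      { eapply Rle_trans; [apply Cmod_triangle|]. rewrite Cmod_opp.
        specialize (Hf (S n)). lra. }
      unfold m. apply Rmult_le_reg_r with (Cmod (g 0%nat) * rho ^ S n).
      + apply Rmult_lt_0_compat; auto.
      + assert (Hpn := Hp (S n)).
        replace (_ / _ / _ * _) with
          (Cmod (f (S n) - sum_n (fun i => CPS_div f g i * g (S n - i)%nat) n)%C)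
          by (field; split; lra).
        replace (_ * _) with (M * rho ^ S n * (1 + sum_n e n)) by (field; lra).
        exact HT. }
  exists (1 + m), ((1 + m) * rho). split; [apply Rmult_lt_0_compat; lra|].
  intro n. rewrite He, Rpow_mult_distr, <- Rmult_assoc.
  apply Rmult_le_compat_r; [now apply Rlt_le|apply He0].
Qed.

(** * Power series solutions of the Riccati equation *)

Definition CPS_derive (a : nat -> C) (n : nat) : C := (RtoC (INR (S n)) * a (S n))%C.

Lemma is_Cpseries_derive (a : nat -> C) (M rho t : R) :
  Cgeometric M rho a -> Rabs t * rho < 1 ->
  is_Cpseries (CPS_derive a) t (CPSeries (CPS_derive a) t).
Proof.
  intros Ha Ht. destruct (Cgeometric_radius _ _ _ _ Ha Ht) as [H1 H2].
  rewrite <- CV_radius_derive in H1, H2.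
  assert (E1 : forall n, PS_derive (fun k => Re (a k)) n = Re (CPS_derive a n))
    by (intro n; symmetry; apply Re_RtoC_mult).
  assert (E2 : forall n, PS_derive (fun k => Im (a k)) n = Im (CPS_derive a n))
    by (intro n; symmetry; apply Im_RtoC_mult).
  split; apply PSeries_correct.
  - exact (ex_pseries_ext _ _ _ E1 (CV_radius_inside _ _ H1)).
  - exact (ex_pseries_ext _ _ _ E2 (CV_radius_inside _ _ H2)).
Qed.

(** The left-hand side of the equation is [dw/dr] for [w (r) = CPSeries c (1/r)],
    since [d/dr = - t^2 d/dt] when [t = 1/r]; each coefficient is read off by the
    identity principle. *)
Lemma Riccati_coeffs (c : nat -> C) (e M rho d : R) :
  Cgeometric M rho c -> 0 < d ->
  (forall t, 0 < t < d ->
     (- (RtoC t * (RtoC t * CPSeries (CPS_derive c) t))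
      = RtoC e * (1 + CPSeries c t * CPSeries c t + RtoC t * CPSeries c t))%C) ->
  forall n, (RtoC e * (CPS_one n + CPS_mult c c n + CPS_shift c n)
             + CPS_shift (CPS_shift (CPS_derive c)) n)%C = RtoC 0.
Proof.
  intros Hc Hd H n.
  assert (Hr := proj1 Hc).
  assert (Hr' := Rinv_0_lt_compat _ Hr).
  apply (is_Cpseries_zero (fun n => RtoC e * (CPS_one n + CPS_mult c c n + CPS_shift c n)
             + CPS_shift (CPS_shift (CPS_derive c)) n)%C (Rmin d (/ rho))).
  { now apply Rmin_pos. }
  intros t [Ht0 Ht1].
  assert (Htd : t < d) by (eapply Rlt_le_trans; [exact Ht1|apply Rmin_l]).
  assert (Htr : Rabs t * rho < 1).
  { rewrite Rabs_pos_eq by lra.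
    rewrite <- (Rinv_l rho) by lra. apply Rmult_lt_compat_r; [lra|].
    eapply Rlt_le_trans; [exact Ht1|apply Rmin_r]. }
  replace (RtoC 0) with
    (RtoC e * (1 + CPSeries c t * CPSeries c t + RtoC t * CPSeries c t)
     + RtoC t * (RtoC t * CPSeries (CPS_derive c) t))%C
    by (rewrite <- H by (split; lra); ring).
  apply is_Cpseries_plus.
  - apply is_Cpseries_scal, is_Cpseries_plus; [apply is_Cpseries_plus|].
    + apply is_Cpseries_one.
    + now apply is_Cpseries_mult with M rho M rho.
    + now apply is_Cpseries_shift, CPSeries_correct with M rho.
  - apply is_Cpseries_shift, is_Cpseries_shift.
    now apply is_Cpseries_derive with M rho.
Qed.

Definition Cnonneg (z : C) : Prop := Im z = 0 /\ 0 <= Re z.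

Lemma Cnonneg_mult (y z : C) : Cnonneg y -> Cnonneg z -> Cnonneg (y * z)%C.
Proof.
  intros [H1 H2] [H3 H4]. unfold Cnonneg, Re, Im in *. simpl.
  rewrite H1, H3. split; [ring|]. nra.
Qed.

Lemma Cnonneg_plus (y z : C) : Cnonneg y -> Cnonneg z -> Cnonneg (y + z)%C.
Proof.
  intros [H1 H2] [H3 H4]. unfold Cnonneg, Re, Im in *. simpl. lra.
Qed.

Lemma Cnonneg_RtoC (x : R) : 0 <= x -> Cnonneg (RtoC x).
Proof. now split. Qed.

Lemma Cnonneg_sum_n_m (u : nat -> C) (n m : nat) :
  (forall k, (n <= k <= m)%nat -> Cnonneg (u k)) -> Cnonneg (sum_n_m u n m).
Proof.
  intro H. destruct (Nat.le_gt_cases n m) as [L|L].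
  - induction m as [|m IH].
    + replace n with 0%nat by lia. rewrite sum_n_n. apply H. lia.
    + destruct (Nat.eq_dec n (S m)) as [->|E].
      * rewrite sum_n_n. apply H. lia.
      * rewrite sum_n_Sm by lia. apply Cnonneg_plus; [|apply H; lia].
        apply IH; [intros; apply H; lia|lia].
  - rewrite sum_n_m_zero by lia. now split; [|right].
Qed.

Lemma CPS_mult_split_ends (c : nat -> C) (n : nat) :
  CPS_mult c c (S n) =
  (2 * c 0%nat * c (S n) + sum_n_m (fun i => c i * c (S n - i)%nat) 1 n)%C.
Proof.
  unfold CPS_mult, sum_n. rewrite sum_n_Sm, sum_Sn_m by lia.
  rewrite Nat.sub_diag, Nat.sub_0_r. change plus with Cplus.
  ring.
Qed.

(** Multiplying the recurrence by [c_0^(k+3)] turns [c_i c_(k+1-i)] into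
    [d_i d_(k+1-i)], and the relation [c_0^2 = -1] gives the linear terms [c_k] and
    [c_(k+1)] the signs that make all coefficients positive. *)
Lemma Riccati_rotated_recurrence (c : nat -> C) :
  (c 0%nat * c 0%nat = - 1)%C ->
  (forall k, RtoC (INR k) * c k = CPS_mult c c (S k) + c k)%C ->
  let d := fun k => (c 0%nat ^ S k * c k)%C in
  d 1%nat = RtoC (1 / 2) /\
  forall k, (2 * d (S k) =
     sum_n_m (fun i => d i * d (S k - i)%nat) 1 k + RtoC (INR k - 1) * d k)%C.
Proof.
  intros H0 Hrec d.
  assert (HR : forall k, (2 * d (S k) =
     sum_n_m (fun i => d i * d (S k - i)%nat) 1 k + RtoC (INR k - 1) * d k)%C).
  { intro k. specialize (Hrec k). rewrite CPS_mult_split_ends in Hrec.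
    assert (E : sum_n_m (fun i => d i * d (S k - i)%nat)%C 1 k =
      (c 0%nat ^ (3 + k) * sum_n_m (fun i => c i * c (S k - i)%nat) 1 k)%C).
    { change Cmult with (mult (K := C_Ring)) at 2.
      rewrite <- (sum_n_m_mult_l (K := C_Ring)).
      apply sum_n_m_ext_loc. intros i Hi. change mult with Cmult. unfold d.
      replace (3 + k)%nat with (S i + S (S k - i))%nat by lia.
      rewrite Cpow_add_r.
      match goal with |- ?x = ?y => change (@eq C x y) end. ring. }
    rewrite E. unfold d.
    set (mid := sum_n_m _ 1 k) in *.
    rewrite RtoC_minus.
    replace mid with ((RtoC (INR k) - 1) * c k - 2 * c 0%nat * c (S k))%C
      by (apply (f_equal (fun z => z - c k - 2 * c 0%nat * c (S k))%C) in Hrec;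
          transitivity (RtoC (INR k) * c k - c k - 2 * c 0%nat * c (S k))%C;
          [ring|rewrite Hrec; ring]).
    rewrite !Cpow_S. cbn [Nat.add]. rewrite !Cpow_S.
    set (p := (c 0%nat ^ k)%C). set (x := c 0%nat) in *.
    (* Both sides are altered by multiples of [x * x + 1 = 0] only. *)
    transitivity (- (x * x) * (2 * (x * (x * p) * c (S k))))%C;
      [rewrite H0; ring|].
    transitivity (((x * x + 1) * x * p * (RtoC (INR k) - 1) * c k)
       - (x * x) * (2 * (x * (x * p) * c (S k))))%C;
      [rewrite H0; ring|ring]. }
  split; [|exact HR].
  specialize (HR 0%nat). rewrite sum_n_m_zero in HR by lia.
  (* At [k = 0] the recurrence reads [2 d_1 = - d_0]. *)
  assert (E0 : d 0%nat = RtoC (-1)).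
  { unfold d. simpl. rewrite Cmult_1_r, H0. reflexivity. }
  rewrite E0 in HR. simpl INR in HR.
  change zero with (RtoC 0) in HR.
  transitivity (RtoC (1/2) * (2 * d 1%nat))%C.
  - rewrite Cmult_assoc, <- RtoC_mult. replace (1 / 2 * 2) with 1 by field. ring.
  - rewrite HR, Cplus_0_l, <- !RtoC_mult. f_equal. field.
Qed.

(** Unfolding the growth hypothesis gives [e_n >= a n! / 2^n], and
    [(2 rho)^n / n!] tends to zero. *)
Lemma factorial_growth_not_geometric (e : nat -> R) (a M rho : R) :
  0 < a -> 0 < rho -> e 0%nat = a ->
  (forall n, INR (S n) / 2 * e n <= e (S n)) ->
  (forall n, e n <= M * rho ^ n) -> False.
Proof.
  intros Ha Hr H0 HS HM.
  assert (L : forall n, a * INR (fact n) <= 2 ^ n * e n).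
  { induction n as [|n IH]; [simpl; lra|].
    rewrite fact_simpl, mult_INR. cbn [pow].
    assert (0 <= INR (S n)) by apply pos_INR.
    assert (0 < 2 ^ n) by (apply pow_lt; lra).
    specialize (HS n).
    apply Rle_trans with (INR (S n) * (2 ^ n * e n)).
    - transitivity (INR (S n) * (a * INR (fact n))); [right; ring|].
      now apply Rmult_le_compat_l.
    - transitivity (2 * 2 ^ n * (INR (S n) / 2 * e n)); [right; field|].
      apply Rmult_le_compat_l; [lra|exact HS]. }
  assert (L2 : forall n, a <= M * ((2 * rho) ^ n / INR (fact n))).
  { intro n. assert (F := INR_fact_lt_0 n).
    apply Rmult_le_reg_r with (INR (fact n)); [exact F|].
    eapply Rle_trans; [apply L|].
    replace (M * ((2 * rho) ^ n / INR (fact n)) * INR (fact n))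
      with (2 ^ n * (M * rho ^ n)) by (rewrite Rpow_mult_distr; field; lra).
    apply Rmult_le_compat_l; [apply pow_le; lra|apply HM]. }
  assert (HMp : 0 < M).
  { specialize (HM 0%nat). simpl in HM. lra. }
  destruct (cv_speed_pow_fact (2 * rho) (a / M)) as [n Hn].
  { now apply Rdiv_lt_0_compat. }
  specialize (Hn n (le_n n)). unfold R_dist in Hn.
  rewrite Rminus_0_r in Hn. apply Rabs_def2 in Hn. destruct Hn as [Hn _].
  apply (Rmult_lt_compat_l M) in Hn; [|exact HMp].
  replace (M * (a / M)) with a in Hn by (field; lra).
  specialize (L2 n). lra.
Qed.

(** By induction all [d_k] with [k >= 1] are real and nonnegative; the linear term of
    the recurrence alone then forces factorial growth from [d_2 = 1/8] on, and
    [|c_k| = |d_k|] because [|c_0| = 1]. *)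
Lemma Riccati_divergent (c : nat -> C) (M rho : R) :
  Cgeometric M rho c -> (c 0%nat * c 0%nat = - 1)%C ->
  (forall k, RtoC (INR k) * c k = CPS_mult c c (S k) + c k)%C -> False.
Proof.
  intros [Hr Hc] H0 Hrec.
  destruct (Riccati_rotated_recurrence c H0 Hrec) as [D1 DS].
  set (d := fun k => (c 0%nat ^ S k * c k)%C) in *.
  change (d 1%nat = RtoC (1 / 2)) in D1.
  assert (half : forall k, d (S k) = (RtoC (1/2) *
     (sum_n_m (fun i => d i * d (S k - i)%nat) 1 k + RtoC (INR k - 1) * d k))%C).
  { intro k. transitivity (RtoC (1/2) * (2 * d (S k)))%C.
    - rewrite Cmult_assoc, <- RtoC_mult. replace (1 / 2 * 2) with 1 by field. ring.
    - f_equal. exact (DS k). }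
  assert (N : forall k, Cnonneg (d (S k))).
  { intro k. induction k as [k IH] using (well_founded_induction lt_wf). destruct k as [|k].
    - rewrite D1. apply Cnonneg_RtoC. lra.
    - rewrite half. apply Cnonneg_mult; [apply Cnonneg_RtoC; lra|].
      apply Cnonneg_plus.
      + apply Cnonneg_sum_n_m. intros i Hi. apply Cnonneg_mult.
        * replace i with (S (i - 1)) by lia. apply IH. lia.
        * replace (S (S k) - i)%nat with (S (S k - i)) by lia. apply IH. lia.
      + apply Cnonneg_mult; [|apply IH; lia]. apply Cnonneg_RtoC.
        rewrite S_INR. generalize (pos_INR k). lra. }
  assert (Mc : Cmod (c 0%nat) = 1).
  { assert (E : Cmod (c 0%nat) * Cmod (c 0%nat) = 1)
      by (rewrite <- Cmod_mult, H0, Cmod_R, Rabs_left; lra).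
    generalize (Cmod_ge_0 (c 0%nat)). nra. }
  (* The factor [k - 1] vanishes at [k = 1], so the growth starts from [d_2]. *)
  apply (factorial_growth_not_geometric (fun n => Re (d (S (S n)))) (1 / 8) (M * rho ^ 2) rho);
    [lra|exact Hr| | |].
  - rewrite half, sum_n_n. cbn [Nat.sub]. rewrite D1. simpl INR.
    rewrite <- !RtoC_mult, <- RtoC_plus, <- RtoC_mult. simpl. field.
  - intro n. rewrite (half (S (S n))), Re_RtoC_mult.
    assert (P : Cnonneg (sum_n_m (fun i => d i * d (S (S (S n)) - i)%nat)%C 1 (S (S n)))).
    { apply Cnonneg_sum_n_m. intros i Hi. apply Cnonneg_mult.
      - replace i with (S (i - 1)) by lia. apply N.
      - replace (S (S (S n)) - i)%nat with (S (S (S n) - i)) by lia. apply N. }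
    destruct P as [_ P]. revert P.
    generalize (sum_n_m (fun i => d i * d (S (S (S n)) - i)%nat)%C 1 (S (S n))).
    intros z P.
    rewrite (S_INR (S n)).
    match goal with |- context [Re (?u + ?v)%C] =>
      change (Re (u + v)%C) with (Re u + Re v) end.
    rewrite Re_RtoC_mult. lra.
  - intro n. eapply Rle_trans; [apply Rle_abs|].
    eapply Rle_trans; [apply re_le_Cmod|].
    unfold d. rewrite Cmod_mult, Cmod_pow, Mc, pow1, Rmult_1_l.
    eapply Rle_trans; [apply Hc|]. right. simpl. ring.
Qed.

(** * Bessel functions of orders zero and one *)

(** The even part: [J_n (x) = (x/2)^n F ((x/2)^2)] where [F] has these coefficients;
    [Y_coeff] plays the same role in the last term of [Y_n]. *)
Definition J_coeff (n k : nat) : R := (-1) ^ k / (INR (fact k) * INR (fact (n + k))).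

Definition Y_coeff (n k : nat) : R := J_coeff n k * (harmonic k + harmonic (n + k)).

Lemma bessel_J_PSeries (n : nat) (x : R) :
  bessel_J n x = (x / 2) ^ n * PSeries (J_coeff n) ((x / 2) ^ 2).
Proof.
  unfold bessel_J, PSeries. rewrite <- Series_scal_l. apply Series_ext. intro k.
  rewrite pow_add, pow_mult. unfold J_coeff. ring.
Qed.

Lemma bessel_Y_PSeries (n : nat) (x : R) :
  bessel_Y n x = 2 / PI * (ln (x / 2) + euler_gamma) * bessel_J n x
    - 1 / PI * bessel_Y_polar n x
    - 1 / PI * ((x / 2) ^ n * PSeries (Y_coeff n) ((x / 2) ^ 2)).
Proof.
  unfold bessel_Y, PSeries.
  rewrite <- (Series_scal_l ((x / 2) ^ n)). do 2 f_equal.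
  apply Series_ext. intro k.
  rewrite pow_add, pow_mult. unfold Y_coeff, J_coeff. ring.
Qed.

Lemma harmonic_S (n : nat) : harmonic (S n) = harmonic n + / INR (S n).
Proof. unfold harmonic. rewrite sum_n_Sm by lia. reflexivity. Qed.

Lemma harmonic_bounds (n : nat) : 0 <= harmonic n <= INR n.
Proof.
  induction n as [|n IH].
  - unfold harmonic. rewrite sum_n_m_zero by lia. simpl. split; right; reflexivity.
  - rewrite harmonic_S, S_INR. assert (H := pos_INR n).
    assert (0 < / (INR n + 1)) by (apply Rinv_0_lt_compat; lra).
    assert (/ (INR n + 1) <= / 1) by (apply Rinv_le_contravar; lra).
    rewrite Rinv_1 in *. lra.
Qed.

(** A bound that makes the power series entire. The constant [2] is the one
    that suits [Y_coeff], through [harmonic k + harmonic (n + k) <= 2 (n + k)!]. *)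
Definition exp_bounded (a : nat -> R) : Prop :=
  forall k, Rabs (a k) <= 2 / INR (fact k).

Lemma Rabs_J_coeff (n k : nat) :
  Rabs (J_coeff n k) = / (INR (fact k) * INR (fact (n + k))).
Proof.
  unfold J_coeff, Rdiv. rewrite Rabs_mult, pow_1_abs, Rmult_1_l.
  apply Rabs_pos_eq. left. apply Rinv_0_lt_compat.
  apply Rmult_lt_0_compat; apply INR_fact_lt_0.
Qed.

Lemma J_coeff_exp_bounded (n : nat) : exp_bounded (J_coeff n).
Proof.
  intro k.
  rewrite Rabs_J_coeff, Rinv_mult.
  assert (H1 := INR_fact_lt_0 k). assert (H2 := le_INR _ _ (lt_O_fact (n + k))).
  simpl in H2.
  assert (/ INR (fact (n + k)) <= / 1) by (apply Rinv_le_contravar; lra).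
  rewrite Rinv_1 in *. unfold Rdiv. rewrite (Rmult_comm 2).
  apply Rmult_le_compat_l; [|lra]. left. now apply Rinv_0_lt_compat.
Qed.

Lemma INR_le_fact (m : nat) : INR m <= INR (fact m).
Proof.
  destruct m as [|m]; [simpl; lra|]. rewrite fact_simpl, mult_INR.
  rewrite <- (Rmult_1_r (INR (S m))) at 1.
  apply Rmult_le_compat_l; [apply pos_INR|]. apply (le_INR 1), lt_O_fact.
Qed.

Lemma Y_coeff_exp_bounded (n : nat) : exp_bounded (Y_coeff n).
Proof.
  intro k.
  unfold Y_coeff. rewrite Rabs_mult, Rabs_J_coeff.
  assert (H1 := harmonic_bounds k). assert (H2 := harmonic_bounds (n + k)).
  rewrite Rabs_pos_eq by lra.
  assert (F1 := INR_fact_lt_0 k). assert (F2 := INR_fact_lt_0 (n + k)).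
  assert (H3 := INR_le_fact (n + k)).
  assert (H4 : INR k <= INR (n + k)) by (apply le_INR; lia).
  apply Rmult_le_reg_r with (INR (fact k) * INR (fact (n + k))).
  { now apply Rmult_lt_0_compat. }
  field_simplify; lra.
Qed.

Lemma CV_radius_exp_bounded (a : nat -> R) (x : R) :
  exp_bounded a -> Rbar_lt (Rabs x) (CV_radius a).
Proof.
  intro Ha. assert (Hx := Rabs_pos x).
  assert (Hy : 0 < Rabs x + 1) by lra.
  apply CV_radius_geometric with (2 * exp (Rabs x + 1)) (/ (Rabs x + 1)).
  - now apply Rinv_0_lt_compat.
  - intro k. eapply Rle_trans; [apply Ha|].
    assert (F := INR_fact_lt_0 k). assert (P := pow_lt _ k Hy).
    rewrite pow_inv. apply Rmult_le_reg_r with ((Rabs x + 1) ^ k); [exact P|].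
    rewrite (Rmult_assoc _ (/ _)), Rinv_l, Rmult_1_r by lra.
    unfold Rdiv. rewrite !Rmult_assoc. apply Rmult_le_compat_l; [lra|].
    rewrite Rmult_comm.
    eapply Rle_trans; [|apply (exp_ge_taylor _ k); lra].
    destruct k as [|k]; [apply Rle_refl|]. rewrite tech5.
    assert (0 <= sum_f_R0 (fun i => (Rabs x + 1) ^ i / INR (fact i)) k).
    { apply cond_pos_sum. intro i. apply Rmult_le_pos; [apply pow_le; lra|].
      left. apply Rinv_0_lt_compat, INR_fact_lt_0. }
    unfold Rdiv in *. lra.
  - apply Rmult_lt_reg_r with (Rabs x + 1); [exact Hy|].
    rewrite Rmult_assoc, Rinv_l; lra.
Qed.

(** The next four relations between coefficients are the Bessel derivative formulas
    [J_0' = - J_1], [(x J_1)' = x J_0], [Y_0' = - Y_1] and [(x Y_1)' = x Y_0]. In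
    those for [Y], the difference [harmonic (S k) - harmonic k = 1 / (k + 1)]
    produces the [J] coefficient that compensates the derivative of the
    logarithm. *)
Lemma J_coeff_0_S (k : nat) : INR (S k) * J_coeff 0 (S k) = - J_coeff 1 k.
Proof.
  unfold J_coeff. cbn [Nat.add]. rewrite (fact_simpl k), mult_INR. simpl pow.
  assert (F := INR_fact_neq_0 k). assert (S' := not_0_INR (S k) ltac:(lia)).
  field. now split.
Qed.

Lemma J_coeff_1 (k : nat) : INR (S k) * J_coeff 1 k = J_coeff 0 k.
Proof.
  unfold J_coeff. cbn [Nat.add]. rewrite (fact_simpl k), mult_INR.
  assert (F := INR_fact_neq_0 k). assert (S' := not_0_INR (S k) ltac:(lia)).
  field. now split.
Qed.

Lemma Y_coeff_0_S (k : nat) :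
  INR (S k) * Y_coeff 0 (S k) + Y_coeff 1 k = J_coeff 0 (S k).
Proof.
  unfold Y_coeff. cbn [Nat.add]. rewrite <- Rmult_assoc, J_coeff_0_S, harmonic_S.
  assert (S' := not_0_INR (S k) ltac:(lia)).
  apply Rmult_eq_reg_l with (INR (S k)); [|exact S'].
  rewrite J_coeff_0_S. field. exact S'.
Qed.

Lemma Y_coeff_1 (k : nat) :
  INR (S k) * Y_coeff 1 k = J_coeff 1 k + Y_coeff 0 k.
Proof.
  unfold Y_coeff. cbn [Nat.add]. rewrite <- J_coeff_1, harmonic_S.
  assert (S' := not_0_INR (S k) ltac:(lia)). field. exact S'.
Qed.

Lemma is_pseries_exp_bounded (a : nat -> R) (z : R) :
  exp_bounded a -> is_pseries a z (PSeries a z).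
Proof. intro Ha. now apply PSeries_correct, CV_radius_inside, CV_radius_exp_bounded. Qed.

Lemma is_pseries_derive_exp_bounded (a : nat -> R) (z : R) :
  exp_bounded a ->
  is_pseries (PS_derive a) z (PSeries (PS_derive a) z).
Proof.
  intro Ha. apply PSeries_correct, CV_radius_inside. rewrite CV_radius_derive.
  now apply CV_radius_exp_bounded.
Qed.

Lemma PSeries_J0_derive (z : R) :
  PSeries (PS_derive (J_coeff 0)) z = - PSeries (J_coeff 1) z.
Proof.
  rewrite <- PSeries_opp. apply PSeries_ext. intro k. apply J_coeff_0_S.
Qed.

Lemma PSeries_J1_derive (z : R) :
  PSeries (J_coeff 1) z + z * PSeries (PS_derive (J_coeff 1)) z = PSeries (J_coeff 0) z.
Proof.
  rewrite <- PSeries_incr_1.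
  rewrite <- PSeries_plus.
  - apply PSeries_ext. intros [|k].
    + rewrite <- J_coeff_1. unfold PS_plus, PS_incr_1, plus, zero; simpl. ring.
    + rewrite <- J_coeff_1. unfold PS_plus, PS_incr_1, PS_derive.
      change plus with Rplus. rewrite (S_INR (S k)). ring.
  - eexists. apply is_pseries_exp_bounded, J_coeff_exp_bounded.
  - apply ex_pseries_incr_1. eexists. apply is_pseries_derive_exp_bounded, J_coeff_exp_bounded.
Qed.

(** The constant [1] is half of [x] times the polar part [2/x] of [Y_1]. *)
Lemma PSeries_Y0_derive (z : R) :
  1 + z * (PSeries (PS_derive (Y_coeff 0)) z + PSeries (Y_coeff 1) z)
  = PSeries (J_coeff 0) z.
Proof.
  rewrite <- PSeries_plus;
    [|eexists; apply is_pseries_derive_exp_bounded, Y_coeff_exp_bounded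
     |eexists; apply is_pseries_exp_bounded, Y_coeff_exp_bounded].
  rewrite (PSeries_decr_1 (J_coeff 0))
    by (eexists; apply is_pseries_exp_bounded, J_coeff_exp_bounded).
  f_equal; [unfold J_coeff; simpl; field|]. f_equal.
  apply PSeries_ext. intro k. apply Y_coeff_0_S.
Qed.

Lemma PSeries_Y1_derive (z : R) :
  PSeries (Y_coeff 1) z + z * PSeries (PS_derive (Y_coeff 1)) z
  = PSeries (J_coeff 1) z + PSeries (Y_coeff 0) z.
Proof.
  rewrite <- PSeries_incr_1.
  rewrite <- !PSeries_plus;
    try (eexists; apply is_pseries_exp_bounded, Y_coeff_exp_bounded);
    try (eexists; apply is_pseries_exp_bounded, J_coeff_exp_bounded).
  - apply PSeries_ext. intros [|k]; unfold PS_plus at 2; change plus with Rplus;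
      rewrite <- Y_coeff_1.
    + unfold PS_plus, PS_incr_1, plus, zero; simpl. ring.
    + unfold PS_plus, PS_incr_1, PS_derive.
      change plus with Rplus. rewrite (S_INR (S k)). ring.
  - apply ex_pseries_incr_1. eexists. apply is_pseries_derive_exp_bounded, Y_coeff_exp_bounded.
Qed.

Lemma is_derive_exp_bounded (a : nat -> R) (z : R) :
  exp_bounded a ->
  is_derive (PSeries a) z (PSeries (PS_derive a) z).
Proof. intro Ha. now apply is_derive_PSeries, CV_radius_exp_bounded. Qed.

Lemma is_derive_exp_bounded_half_sqr (a : nat -> R) (x : R) :
  exp_bounded a ->
  is_derive (fun x => PSeries a ((x / 2) ^ 2)) x
    (x / 2 * PSeries (PS_derive a) ((x / 2) ^ 2)).
Proof.
  intro Ha.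
  apply (is_derive_comp (PSeries a) (fun x => (x / 2) ^ 2) x _ (x / 2)).
  - now apply is_derive_exp_bounded.
  - auto_derive; [easy|]. field.
Qed.

Lemma is_derive_J0 (x : R) : is_derive (bessel_J 0) x (- bessel_J 1 x).
Proof.
  eapply is_derive_ext; [intro t; symmetry; apply bessel_J_PSeries|].
  assert (D := is_derive_exp_bounded_half_sqr _ x (J_coeff_exp_bounded 0)).
  rewrite bessel_J_PSeries. rewrite PSeries_J0_derive in D.
  eapply is_derive_ext; [intro t; symmetry; apply Rmult_1_l|].
  replace (- _) with (x / 2 * - PSeries (J_coeff 1) ((x / 2) ^ 2)) by ring.
  exact D.
Qed.

Lemma is_derive_half_mult (F : R -> R) (x l : R) :
  is_derive F x l -> is_derive (fun t => t / 2 * F t) x (F x / 2 + x / 2 * l).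
Proof.
  intro D. auto_derive; [now exists l|].
  replace (Derive (fun t => F t) x) with l by (symmetry; now apply is_derive_unique).
  field.
Qed.

Lemma is_derive_J1 (x : R) : x <> 0 ->
  is_derive (bessel_J 1) x (bessel_J 0 x - bessel_J 1 x / x).
Proof.
  intro Hx.
  assert (D := is_derive_half_mult _ _ _
                 (is_derive_exp_bounded_half_sqr _ x (J_coeff_exp_bounded 1))).
  apply is_derive_ext with (fun t => t / 2 * PSeries (J_coeff 1) ((t / 2) ^ 2)).
  { intro t. now rewrite bessel_J_PSeries, (pow_1 (t / 2)). }
  rewrite !bessel_J_PSeries, <- PSeries_J1_derive.
  match type of D with is_derive _ _ ?l => match goal with |- is_derive _ _ ?m =>
    replace m with l; [exact D|field; exact Hx] end end.
Qed.

(** With [J] and [G] abstract the derivative of the expressions for [Y_0] and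
    [Y_1] is computed without unfolding the series. *)
Lemma is_derive_log_part (J G : R -> R) (g x j l : R) :
  0 < x -> is_derive J x j -> is_derive G x l ->
  is_derive (fun t => 2 / PI * (ln (t / 2) + g) * J t - 1 / PI * G t) x
    (2 / PI * (J x / x + (ln (x / 2) + g) * j) - 1 / PI * l).
Proof.
  intros Hx DJ DG. auto_derive.
  - repeat split; [lra|now exists j|now exists l].
  - replace (Derive (fun t => J t) x) with j by (symmetry; now apply is_derive_unique).
    replace (Derive (fun t => G t) x) with l by (symmetry; now apply is_derive_unique).
    assert (P := PI_neq0). change (x * / 2) with (x / 2). field. split; lra.
Qed.

Lemma bessel_Y0_eq (x : R) :
  bessel_Y 0 x = 2 / PI * (ln (x / 2) + euler_gamma) * bessel_J 0 x
                 - 1 / PI * PSeries (Y_coeff 0) ((x / 2) ^ 2).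
Proof. rewrite bessel_Y_PSeries. simpl. ring. Qed.

Lemma bessel_Y1_eq (x : R) :
  bessel_Y 1 x = 2 / PI * (ln (x / 2) + euler_gamma) * bessel_J 1 x
                 - 1 / PI * (/ (x / 2) + x / 2 * PSeries (Y_coeff 1) ((x / 2) ^ 2)).
Proof.
  rewrite bessel_Y_PSeries. unfold bessel_Y_polar. rewrite sum_O. simpl.
  rewrite !Rmult_1_r. unfold Rdiv. rewrite Rinv_1. ring.
Qed.

Lemma is_derive_Y0 (x : R) : 0 < x -> is_derive (bessel_Y 0) x (- bessel_Y 1 x).
Proof.
  intro Hx.
  assert (D := is_derive_log_part _ _ euler_gamma x _ _ Hx (is_derive_J0 x)
                 (is_derive_exp_bounded_half_sqr _ x (Y_coeff_exp_bounded 0))).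
  eapply is_derive_ext; [intro t; symmetry; apply bessel_Y0_eq|].
  assert (P := PI_neq0). assert (E := PSeries_Y0_derive ((x / 2) ^ 2)).
  rewrite bessel_Y1_eq.
  match type of D with is_derive _ _ ?l => match goal with |- is_derive _ _ ?m =>
    replace m with l; [exact D|] end end.
  rewrite (bessel_J_PSeries 0), <- E. simpl (_ ^ 0). field. split; lra.
Qed.

Lemma is_derive_Y1 (x : R) : 0 < x ->
  is_derive (bessel_Y 1) x (bessel_Y 0 x - bessel_Y 1 x / x).
Proof.
  intro Hx.
  assert (DF := is_derive_half_mult _ _ _
                  (is_derive_exp_bounded_half_sqr _ x (Y_coeff_exp_bounded 1))).
  assert (DI : is_derive (fun t => / (t / 2)) x (- (2 / x ^ 2))).
  { auto_derive; [lra|]. field. lra. }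
  assert (D := is_derive_log_part _ _ euler_gamma x _ _ Hx
                 (is_derive_J1 x ltac:(lra)) (is_derive_plus _ _ _ _ _ DI DF)).
  eapply is_derive_ext; [intro t; symmetry; apply bessel_Y1_eq|].
  assert (P := PI_neq0). assert (E := PSeries_Y1_derive ((x / 2) ^ 2)).
  rewrite bessel_Y1_eq, bessel_Y0_eq.
  match type of D with is_derive _ _ ?l => match goal with |- is_derive _ _ ?m =>
    replace m with l; [exact D|] end end.
  change plus with Rplus.
  rewrite (bessel_J_PSeries 1), pow_1.
  replace (PSeries (Y_coeff 0) ((x / 2) ^ 2)) with
    (PSeries (Y_coeff 1) ((x / 2) ^ 2)
     + (x / 2) ^ 2 * PSeries (PS_derive (Y_coeff 1)) ((x / 2) ^ 2)
     - PSeries (J_coeff 1) ((x / 2) ^ 2)) by (rewrite E; ring).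
  field. split; lra.
Qed.

(** The energy [E (t) = t^2 (J_0^2 + J_1^2)] has derivative [2 t J_0^2 >= 0]. If
    [E (x) = 0], then [E], and with it [J_0], vanishes on the whole of [(0, x)],
    so the power series of [J_0] would have constant coefficient zero instead of
    one. *)
Lemma bessel_J_no_common_zero (x : R) :
  0 < x -> bessel_J 0 x = 0 -> bessel_J 1 x = 0 -> False.
Proof.
  intros Hx H0 H1.
  set (E := fun t => t ^ 2 * (bessel_J 0 t ^ 2 + bessel_J 1 t ^ 2)).
  assert (DE : forall t, 0 < t -> is_derive E t (2 * t * bessel_J 0 t ^ 2)).
  { intros t Ht. assert (D0 := is_derive_J0 t).
    assert (D1 := is_derive_J1 t ltac:(lra)). unfold E. revert D0 D1.
    generalize (bessel_J 0) (bessel_J 1). intros f g D0 D1.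
    auto_derive; [repeat split; eexists; eassumption|].
    replace (Derive (fun t => f t) t) with (- g t)
      by (symmetry; now apply is_derive_unique).
    replace (Derive (fun t => g t) t) with (f t - g t / t)
      by (symmetry; now apply is_derive_unique).
    field. lra. }
  assert (Z : forall t, 0 < t < x -> bessel_J 0 t = 0).
  { intros t Ht.
    destruct (MVT_gen E t x (fun t => 2 * t * bessel_J 0 t ^ 2)) as [s [Hs HE]].
    - intros s Hs. apply DE. rewrite Rmin_left, Rmax_right in Hs; lra.
    - intros s Hs. rewrite Rmin_left, Rmax_right in Hs by lra.
      apply derivable_continuous_pt. exists (2 * s * bessel_J 0 s ^ 2).
      apply is_derive_Reals, DE. lra.
    - rewrite Rmin_left, Rmax_right in Hs by lra.
      assert (P : 0 <= 2 * s * bessel_J 0 s ^ 2 * (x - t)).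
      { apply Rmult_le_pos; [|lra]. apply Rmult_le_pos; [lra|apply pow2_ge_0]. }
      rewrite <- HE in P. unfold E in P. rewrite H0, H1 in P.
      assert (Q : t ^ 2 * (bessel_J 0 t ^ 2 + bessel_J 1 t ^ 2) <= 0) by lra.
      assert (T : 0 < t ^ 2) by (apply pow_lt; lra).
      assert (A := pow2_ge_0 (bessel_J 0 t)). assert (B := pow2_ge_0 (bessel_J 1 t)).
      assert (C : bessel_J 0 t ^ 2 = 0) by nra.
      apply Rsqr_0_uniq. unfold Rsqr. lra. }
  assert (A : J_coeff 0 0 = 0).
  { apply PSeries_zero_right_nbhs_0 with ((x / 2) ^ 2); [apply pow_lt; lra|].
    intros z Hz. assert (Hs : 0 < sqrt z) by (apply sqrt_lt_R0; lra).
    assert (Hs2 : sqrt z * sqrt z = z) by (apply sqrt_sqrt; lra).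
    replace 0 with (PSeries (J_coeff 0) z);
      [apply is_pseries_exp_bounded, J_coeff_exp_bounded|].
    (* [x = 2 sqrt z] is the solution of [(x/2)^2 = z]. *)
    rewrite <- (Z (2 * sqrt z)), bessel_J_PSeries.
    - replace ((2 * sqrt z / 2) ^ 2) with z by (rewrite <- Hs2 at 1; field).
      simpl. ring.
    - split; [lra|]. assert (x / 2 > sqrt z); [|lra].
      apply Rnot_le_gt. intro L. nra. }
  unfold J_coeff in A. simpl in A. lra.
Qed.

(** * Hankel functions and their ratio *)

(** Derivative of a complex-valued function of a real variable, by components so
    that the product rule follows from the real one. *)
Definition is_Cderive (f : R -> C) (x : R) (l : C) : Prop :=
  is_derive (fun t => Re (f t)) x (Re l) /\ is_derive (fun t => Im (f t)) x (Im l).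

Lemma is_Cderive_plus (f g : R -> C) (x : R) (l m : C) :
  is_Cderive f x l -> is_Cderive g x m -> is_Cderive (fun t => f t + g t)%C x (l + m)%C.
Proof.
  intros [H1 H2] [H3 H4]. split.
  - exact (is_derive_plus _ _ _ _ _ H1 H3).
  - exact (is_derive_plus _ _ _ _ _ H2 H4).
Qed.

Lemma is_Cderive_mult (f g : R -> C) (x : R) (l m : C) :
  is_Cderive f x l -> is_Cderive g x m ->
  is_Cderive (fun t => f t * g t)%C x (l * g x + f x * m)%C.
Proof.
  intros [H1 H2] [H3 H4].
  assert (P : forall u v du dv, is_derive u x du -> is_derive v x dv ->
    is_derive (fun t => u t * v t) x (du * v x + u x * dv)).
  { intros u v du dv Hu Hv. exact (is_derive_mult u v x du dv Hu Hv Rmult_comm). }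
  split.
  - replace (Re (l * g x + f x * m)%C) with
      (minus (Re l * Re (g x) + Re (f x) * Re m)
             (Im l * Im (g x) + Im (f x) * Im m))
      by (unfold minus, plus, opp, Re, Im; simpl; ring).
    exact (is_derive_minus _ _ _ _ _ (P _ _ _ _ H1 H3) (P _ _ _ _ H2 H4)).
  - replace (Im (l * g x + f x * m)%C) with
      (plus (Re l * Im (g x) + Re (f x) * Im m)
            (Im l * Re (g x) + Im (f x) * Re m))
      by (unfold plus, Re, Im; simpl; ring).
    exact (is_derive_plus _ _ _ _ _ (P _ _ _ _ H1 H4) (P _ _ _ _ H2 H3)).
Qed.

Lemma is_derive_zero_right (f : R -> R) (a x l : R) :
  (forall t, a < t -> f t = 0) -> a < x -> is_derive f x l -> l = 0.
Proof.
  intros Hf Hx D. rewrite <- (is_derive_unique _ _ _ D).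
  rewrite <- (Derive_const 0 x). apply Derive_ext_loc.
  assert (Hd : 0 < x - a) by lra.
  exists (mkposreal _ Hd). intros t Ht. apply Hf.
  change (Rabs (t - x) < x - a) in Ht. apply Rabs_def2 in Ht. lra.
Qed.

Lemma is_Cderive_zero_right (f : R -> C) (a x : R) (l : C) :
  (forall t, a < t -> f t = 0%C) -> a < x -> is_Cderive f x l -> l = 0%C.
Proof.
  intros Hf Hx [D1 D2].
  apply (is_derive_zero_right _ a) in D1; [|intros t Ht; now rewrite Hf|exact Hx].
  apply (is_derive_zero_right _ a) in D2; [|intros t Ht; now rewrite Hf|exact Hx].
  destruct l as [u v]. simpl in *. now subst.
Qed.

Lemma Rabs_inv_mult_lt_1 (rho r : R) : 0 < rho -> rho < r -> Rabs (/ r) * rho < 1.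
Proof.
  intros Hrho Hr. rewrite Rabs_inv, Rabs_pos_eq by lra.
  apply Rmult_lt_reg_l with r; [lra|].
  rewrite <- Rmult_assoc, Rinv_r by lra. lra.
Qed.

Lemma is_Cderive_CPSeries_inv (c : nat -> C) (M rho r : R) :
  Cgeometric M rho c -> rho < r ->
  is_Cderive (fun r => CPSeries c (/ r)) r
    (- (RtoC (/ r) * (RtoC (/ r) * CPSeries (CPS_derive c) (/ r))))%C.
Proof.
  intros Hc Hr. assert (Hrho := proj1 Hc).
  assert (Ht := Rabs_inv_mult_lt_1 rho r Hrho Hr).
  destruct (Cgeometric_radius _ _ _ _ Hc Ht) as [H1 H2].
  assert (P : forall a, Rbar_lt (Rabs (/ r)) (CV_radius a) ->
    is_derive (fun r => PSeries a (/ r)) r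
      (- (/ r * (/ r * PSeries (PS_derive a) (/ r))))).
  { intros a Ha.
    replace (- _) with (- / r ^ 2 * PSeries (PS_derive a) (/ r)) by (field; lra).
    apply (is_derive_comp (PSeries a) Rinv r); [now apply is_derive_PSeries|].
    auto_derive; [lra|]. field; lra. }
  assert (E1 : Re (CPSeries (CPS_derive c) (/ r))
               = PSeries (PS_derive (fun k => Re (c k))) (/ r)).
  { apply PSeries_ext. intro n. apply Re_RtoC_mult. }
  assert (E2 : Im (CPSeries (CPS_derive c) (/ r))
               = PSeries (PS_derive (fun k => Im (c k))) (/ r)).
  { apply PSeries_ext. intro n. apply Im_RtoC_mult. }
  split.
  - change (is_derive (fun r => PSeries (fun k => Re (c k)) (/ r)) r
      (- Re (RtoC (/ r) * (RtoC (/ r) * CPSeries (CPS_derive c) (/ r)))%C)).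
    rewrite !Re_RtoC_mult, E1. exact (P _ H1).
  - change (is_derive (fun r => PSeries (fun k => Im (c k)) (/ r)) r
      (- Im (RtoC (/ r) * (RtoC (/ r) * CPSeries (CPS_derive c) (/ r)))%C)).
    rewrite !Im_RtoC_mult, E2. exact (P _ H2).
Qed.

Lemma Re_hankel1 (n : nat) (x : R) : Re (hankel1 n x) = bessel_J n x.
Proof. unfold hankel1, Re. cbn -[bessel_J bessel_Y]. ring. Qed.

Lemma Im_hankel1 (n : nat) (x : R) : Im (hankel1 n x) = bessel_Y n x.
Proof. unfold hankel1, Im. cbn -[bessel_J bessel_Y]. ring. Qed.

Lemma is_Cderive_hankel0 (x : R) :
  0 < x -> is_Cderive (hankel1 0) x (- hankel1 1 x)%C.
Proof.
  intro Hx. split.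
  - apply is_derive_ext with (bessel_J 0); [intro; symmetry; apply Re_hankel1|].
    change (Re (- hankel1 1 x)%C) with (- Re (hankel1 1 x)). rewrite Re_hankel1.
    apply is_derive_J0.
  - apply is_derive_ext with (bessel_Y 0); [intro; symmetry; apply Im_hankel1|].
    change (Im (- hankel1 1 x)%C) with (- Im (hankel1 1 x)). rewrite Im_hankel1.
    now apply is_derive_Y0.
Qed.

Lemma is_Cderive_hankel1 (x : R) :
  0 < x -> is_Cderive (hankel1 1) x (hankel1 0 x - RtoC (/ x) * hankel1 1 x)%C.
Proof.
  intro Hx. split.
  - apply is_derive_ext with (bessel_J 1); [intro; symmetry; apply Re_hankel1|].
    change (Re (hankel1 0 x - RtoC (/ x) * hankel1 1 x)%C)
      with (Re (hankel1 0 x) - Re (RtoC (/ x) * hankel1 1 x)%C).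
    rewrite Re_RtoC_mult, !Re_hankel1, Rmult_comm. apply is_derive_J1. lra.
  - apply is_derive_ext with (bessel_Y 1); [intro; symmetry; apply Im_hankel1|].
    change (Im (hankel1 0 x - RtoC (/ x) * hankel1 1 x)%C)
      with (Im (hankel1 0 x) - Im (RtoC (/ x) * hankel1 1 x)%C).
    rewrite Im_RtoC_mult, !Im_hankel1, Rmult_comm. now apply is_derive_Y1.
Qed.

Lemma hankel1_no_common_zero (x : R) :
  0 < x -> hankel1 0 x = 0%C -> hankel1 1 x = 0%C -> False.
Proof.
  intros Hx H0 H1. apply (bessel_J_no_common_zero x Hx);
    rewrite <- Re_hankel1; [rewrite H0|rewrite H1]; reflexivity.
Qed.

Lemma CPSeries_nonzero_near_0 (a : nat -> C) (M rho : R) :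
  Cgeometric M rho a -> a 0%nat <> 0%C ->
  exists e : posreal, forall t, Rabs t < e -> CPSeries a t <> 0%C.
Proof.
  intros Ha H0. destruct (Cgeometric_radius M rho 0 a Ha) as [R1 R2].
  { rewrite Rabs_R0. lra. }
  rewrite Rabs_R0 in R1, R2.
  destruct (Req_dec (Re (a 0%nat)) 0) as [E|E].
  - destruct (Req_dec (Im (a 0%nat)) 0) as [E'|E'].
    + exfalso. apply H0. destruct (a 0%nat) as [u v]. simpl in *. now subst.
    + destruct (PSeries_nonzero_near_0 _ R2 E') as [e He].
      exists e. intros t Ht Hz. apply (He t Ht). exact (f_equal Im Hz).
  - destruct (PSeries_nonzero_near_0 _ R1 E) as [e He].
    exists e. intros t Ht Hz. apply (He t Ht). exact (f_equal Re Hz).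
Qed.

(** The functions [P] and [Q] are kept abstract because both [H1 / H0] and
    [H0 / H1] have to be expanded. The range [r > r0] avoids the zeros of [g] and
    lies in the disk of convergence of the quotient. *)
Lemma ratio_expansion (P Q : R -> C) (f g : nat -> C) (M rho : R) :
  Cgeometric M rho f -> Cgeometric M rho g -> g 0%nat <> 0%C ->
  (forall r, rho < r -> (P r * CPSeries f (/ r) + Q r * CPSeries g (/ r))%C = 0%C) ->
  exists (c : nat -> C) (N sigma : R),
    Cgeometric N sigma c /\ (c 0%nat * g 0%nat)%C = f 0%nat /\
    exists r0, sigma <= r0 /\
      forall r, r0 < r -> (P r * CPSeries c (/ r) + Q r)%C = 0%C.
Proof.
  intros Hf Hg G0 H. assert (Hrho := proj1 Hf).
  destruct (Cgeometric_CPS_div f g M rho G0 Hf Hg) as [N [sigma Hc]].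
  exists (CPS_div f g), N, sigma. split; [exact Hc|]. split.
  { rewrite <- (CPS_mult_CPS_div f g 0 G0). unfold CPS_mult. now rewrite sum_O. }
  destruct (CPSeries_nonzero_near_0 g M rho Hg G0) as [e He].
  assert (He0 := cond_pos e). assert (Hs := proj1 Hc).
  exists (Rmax sigma (Rmax rho (/ e))). split; [apply Rmax_l|].
  intros r Hr.
  assert (Hr1 := Rmax_l sigma (Rmax rho (/ e))).
  assert (Hr2 := Rmax_r sigma (Rmax rho (/ e))).
  assert (Hr3 := Rmax_l rho (/ e)).
  assert (Hr4 := Rmax_r rho (/ e)).
  assert (Ng : CPSeries g (/ r) <> 0%C).
  { apply He. rewrite Rabs_pos_eq.
    - rewrite <- (Rinv_inv e). apply Rinv_0_lt_contravar; [|lra].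
      now apply Rinv_0_lt_compat.
    - left. apply Rinv_0_lt_compat. lra. }
  assert (E : CPSeries f (/ r) = (CPSeries (CPS_div f g) (/ r) * CPSeries g (/ r))%C).
  { apply is_Cpseries_unique.
    assert (C := is_Cpseries_mult _ _ N sigma M rho (/ r) Hc Hg
       (Rabs_inv_mult_lt_1 _ r Hs ltac:(lra)) (Rabs_inv_mult_lt_1 _ r Hrho ltac:(lra))).
    destruct C as [C1 C2]. split.
    - refine (is_pseries_ext _ _ _ _ _ C1). intro n. now rewrite CPS_mult_CPS_div.
    - refine (is_pseries_ext _ _ _ _ _ C2). intro n. now rewrite CPS_mult_CPS_div. }
  specialize (H r ltac:(lra)). rewrite E in H.
  assert (F : ((P r * CPSeries (CPS_div f g) (/ r) + Q r) * CPSeries g (/ r))%C = 0%C)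
    by (rewrite <- H; ring).
  destruct (Ceq_dec (P r * CPSeries (CPS_div f g) (/ r) + Q r)%C 0) as [Z|Z]; [exact Z|].
  exfalso. now apply (Cmult_neq_0 _ _ Z Ng).
Qed.

(** Differentiating [P w + Q = 0] and substituting [Q = - P w] gives [P] times the
    Riccati equation, and [P] has no zero [r > r0], since [Q] would vanish there
    too. The signs cover both orders of the pair: [e = -1] for
    [(P, Q) = (H0, H1)] and [e = 1] for [(P, Q) = (H1, H0)]. *)
Lemma ratio_Riccati (P Q : R -> C) (e alpha beta : R) (c : nat -> C)
    (N sigma r0 : R) :
  Cgeometric N sigma c -> sigma <= r0 -> e = alpha - beta ->
  (forall r, 0 < r ->
     is_Cderive P r (RtoC e * Q r - RtoC alpha * (RtoC (/ r) * P r))%C) ->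
  (forall r, 0 < r ->
     is_Cderive Q r (- (RtoC e * P r) - RtoC beta * (RtoC (/ r) * Q r))%C) ->
  (forall r, 0 < r -> P r = 0%C -> Q r = 0%C -> False) ->
  (forall r, r0 < r -> (P r * CPSeries c (/ r) + Q r)%C = 0%C) ->
  forall t, 0 < t < / r0 ->
     (- (RtoC t * (RtoC t * CPSeries (CPS_derive c) t))
      = RtoC e * (1 + CPSeries c t * CPSeries c t + RtoC t * CPSeries c t))%C.
Proof.
  intros Hc Hr0 He DP DQ NZ Hw t Ht. assert (Hs := proj1 Hc).
  assert (Hr : r0 < / t).
  { rewrite <- (Rinv_inv r0). apply Rinv_0_lt_contravar; lra. }
  assert (D := is_Cderive_plus _ _ _ _ _
    (is_Cderive_mult _ _ _ _ _ (DP (/ t) ltac:(lra))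
       (is_Cderive_CPSeries_inv c N sigma (/ t) Hc ltac:(lra)))
    (DQ (/ t) ltac:(lra))).
  apply (is_Cderive_zero_right _ r0 _ _ Hw Hr) in D.
  specialize (Hw _ Hr). cbv beta in D. rewrite Rinv_inv in D, Hw.
  set (w := CPSeries c t) in *. set (dw := CPSeries (CPS_derive c) t) in *.
  assert (NZP : P (/ t) <> 0%C).
  { intro Z. apply (NZ (/ t)); [lra|exact Z|]. rewrite <- Hw, Z. ring. }
  assert (EQ : Q (/ t) = (- (P (/ t)%R * w))%C).
  { transitivity (P (/ t)%R * w + Q (/ t)%R - P (/ t)%R * w)%C; [ring|rewrite Hw; ring]. }
  rewrite EQ in D. set (h := P (/ t)) in *.
  set (rhs := (RtoC e * (1 + w * w + RtoC t * w))%C).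
  assert (F : (h * (- (RtoC t * (RtoC t * dw)) - rhs))%C = 0%C).
  { rewrite <- D. unfold rhs. rewrite He, RtoC_minus. ring. }
  destruct (Ceq_dec (- (RtoC t * (RtoC t * dw)) - rhs)%C 0) as [Z|Z];
    [|exfalso; now apply (Cmult_neq_0 _ _ NZP Z)].
  transitivity ((- (RtoC t * (RtoC t * dw)) - rhs) + rhs)%C; [ring|].
  rewrite Z. ring.
Qed.

(** Otherwise [w = f / g] would be a convergent solution of the Riccati equation
    that has only divergent ones. *)
Lemma hankel_leading_coeff_1 (A B : nat -> C) (M rho : R) :
  Cgeometric M rho A -> Cgeometric M rho B ->
  (forall r, rho < r -> (hankel1 0 r * CPSeries A (/ r)
                         + hankel1 1 r * CPSeries B (/ r))%C = 0%C) ->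
  B 0%nat = 0%C.
Proof.
  intros HA HB H.
  destruct (Ceq_dec (B 0%nat) 0) as [B0|B0]; [exact B0|exfalso].
  destruct (ratio_expansion _ _ A B M rho HA HB B0 H)
    as (c & N & sigma & Hc & _ & r0 & Hr0 & Hw).
  assert (Hs := proj1 Hc).
  assert (K : forall n, (RtoC (-1) * (CPS_one n + CPS_mult c c n + CPS_shift c n)
             + CPS_shift (CPS_shift (CPS_derive c)) n)%C = RtoC 0).
  { apply Riccati_coeffs with N sigma (/ r0); [exact Hc|apply Rinv_0_lt_compat; lra|].
    apply (ratio_Riccati (hankel1 0) (hankel1 1) (-1) 0 1 c N sigma r0);
      [exact Hc|exact Hr0|ring| | |exact hankel1_no_common_zero|exact Hw].
    - intros r Hr. replace (_ - _)%C with (- hankel1 1 r)%C by ring.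
      now apply is_Cderive_hankel0.
    - intros r Hr. replace (- _ - _)%C
        with (hankel1 0 r - RtoC (/ r) * hankel1 1 r)%C by ring.
      now apply is_Cderive_hankel1. }
  apply (Riccati_divergent c N sigma Hc).
  - specialize (K 0%nat). simpl in K. unfold CPS_mult in K.
    rewrite sum_O, Nat.sub_diag in K.
    transitivity (RtoC (-1) - (RtoC (-1) * (1 + c 0%nat * c 0%nat + 0) + 0))%C;
      [ring|]. rewrite K. ring.
  - intro k. specialize (K (S k)).
    (* The operator [t^2 d/dt] sends [c_k t^k] to [k c_k t^(k+1)]. *)
    assert (E : CPS_shift (CPS_shift (CPS_derive c)) (S k) = (RtoC (INR k) * c k)%C).
    { destruct k as [|k]; [simpl; ring|reflexivity]. }
    rewrite E in K. cbn [CPS_one CPS_shift] in K.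
    transitivity ((RtoC (-1) * (0 + CPS_mult c c (S k) + c k) + RtoC (INR k) * c k)
                  + (CPS_mult c c (S k) + c k))%C; [ring|rewrite K; ring].
Qed.

(** Otherwise [u = g / f] would be a convergent solution of [u' = 1 + u^2 + u / r]
    with [u_0 = 0], although the constant coefficient requires [u_0^2 = -1]. *)
Lemma hankel_leading_coeff_0 (A B : nat -> C) (M rho : R) :
  Cgeometric M rho A -> Cgeometric M rho B ->
  (forall r, rho < r -> (hankel1 0 r * CPSeries A (/ r)
                         + hankel1 1 r * CPSeries B (/ r))%C = 0%C) ->
  B 0%nat = 0%C -> A 0%nat = 0%C.
Proof.
  intros HA HB H B0.
  destruct (Ceq_dec (A 0%nat) 0) as [A0|A0]; [exact A0|exfalso].
  destruct (ratio_expansion (hankel1 1) (hankel1 0) B A M rho HB HA A0)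
    as (c & N & sigma & Hc & Hc0 & r0 & Hr0 & Hw).
  { intros r Hr. rewrite Cplus_comm. now apply H. }
  assert (Hs := proj1 Hc).
  assert (K : forall n, (RtoC 1 * (CPS_one n + CPS_mult c c n + CPS_shift c n)
             + CPS_shift (CPS_shift (CPS_derive c)) n)%C = RtoC 0).
  { apply Riccati_coeffs with N sigma (/ r0); [exact Hc|apply Rinv_0_lt_compat; lra|].
    apply (ratio_Riccati (hankel1 1) (hankel1 0) 1 1 0 c N sigma r0);
      [exact Hc|exact Hr0|ring| | | |exact Hw].
    - intros r Hr. replace (_ - _)%C
        with (hankel1 0 r - RtoC (/ r) * hankel1 1 r)%C by ring.
      now apply is_Cderive_hankel1.
    - intros r Hr. replace (- _ - _)%C with (- hankel1 1 r)%C by ring.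
      now apply is_Cderive_hankel0.
    - intros r Hr H1 H0. now apply (hankel1_no_common_zero r). }
  rewrite B0 in Hc0.
  destruct (Ceq_dec (c 0%nat) 0) as [C0|C0]; [|now apply (Cmult_neq_0 _ _ C0 A0)].
  specialize (K 0%nat). simpl in K. unfold CPS_mult in K.
  rewrite sum_O, Nat.sub_diag, C0 in K.
  apply (f_equal Re) in K. simpl in K. lra.
Qed.

(** * Vanishing of all coefficients *)

Lemma CPSeries_decr (a : nat -> C) (M rho t : R) :
  Cgeometric M rho a -> Rabs t * rho < 1 -> a 0%nat = 0%C ->
  CPSeries a t = (RtoC t * CPSeries (fun k => a (S k)) t)%C.
Proof.
  intros Ha Ht H0. destruct (Cgeometric_radius _ _ _ _ Ha Ht) as [R1 R2].
  unfold CPSeries.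
  rewrite (PSeries_decr_1 (fun k => Re (a k))) by now apply CV_radius_inside.
  rewrite (PSeries_decr_1 (fun k => Im (a k))) by now apply CV_radius_inside.
  rewrite H0. unfold PS_decr_1.
  apply injective_projections; simpl; ring.
Qed.

Lemma Cgeometric_decr (a : nat -> C) (M rho : R) :
  Cgeometric M rho a -> Cgeometric (M * rho) rho (fun k => a (S k)).
Proof.
  intros [Hr Ha]. split; [exact Hr|]. intro k.
  rewrite Rmult_assoc. apply (Ha (S k)).
Qed.

(** The induction shifts both sequences, that is, multiplies the relation by [r]. *)
Lemma hankel1_combination_zero (n : nat) (A B : nat -> C) (M rho : R) :
  Cgeometric M rho A -> Cgeometric M rho B ->
  (forall r, rho < r -> (hankel1 0 r * CPSeries A (/ r)
                         + hankel1 1 r * CPSeries B (/ r))%C = 0%C) ->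
  A n = 0%C /\ B n = 0%C.
Proof.
  revert A B M. induction n as [|n IH]; intros A B M HA HB H.
  all: assert (B0 := hankel_leading_coeff_1 A B M rho HA HB H).
  all: assert (A0 := hankel_leading_coeff_0 A B M rho HA HB H B0).
  - now split.
  - apply (IH (fun k => A (S k)) (fun k => B (S k)) (M * rho));
      try now apply Cgeometric_decr.
    intros r Hr. assert (Hrho := proj1 HA).
    assert (Ht := Rabs_inv_mult_lt_1 rho r Hrho Hr).
    specialize (H r Hr).
    rewrite (CPSeries_decr A M rho), (CPSeries_decr B M rho) in H by assumption.
    transitivity (RtoC r * (hankel1 0 r * (RtoC (/ r) * CPSeries (fun k => A (S k)) (/ r))
      + hankel1 1 r * (RtoC (/ r) * CPSeries (fun k => B (S k)) (/ r))))%C.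
    + rewrite RtoC_inv by lra. field. intro Z. apply RtoC_inj in Z. lra.
    + rewrite H. ring.
Qed.

Lemma CSeries_div_pow (A : nat -> C) (r : R) :
  r <> 0 -> CSeries (fun j => A j / RtoC r ^ j)%C = CPSeries A (/ r).
Proof.
  intro Hr.
  assert (E : forall j, (A j / RtoC r ^ j)%C = (RtoC ((/ r) ^ j) * A j)%C).
  { intro j. rewrite pow_inv, RtoC_inv, RtoC_pow by now apply pow_nonzero. apply Cmult_comm. }
  unfold CSeries, CPSeries. f_equal; apply Series_ext; intro j; rewrite E;
    [rewrite Re_RtoC_mult|rewrite Im_RtoC_mult]; apply Rmult_comm.
Qed.

Lemma Cgeometric_of_cv (A : nat -> C) (r : R) :
  0 < r -> ex_series (fun j => Cmod (A j / RtoC r ^ j)%C) ->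
  exists M, Cgeometric M r A.
Proof.
  intros Hr H. apply ex_series_lim_0 in H.
  destruct (filterlim_bounded (K := R_AbsRing) (V := R_NormedModule)
              (fun j => Cmod (A j / RtoC r ^ j)%C)) as [M HM].
  { now exists 0. }
  exists M. split; [exact Hr|]. intro k. specialize (HM k).
  change (Rabs (Cmod (A k / RtoC r ^ k)%C) <= M) in HM.
  rewrite Rabs_pos_eq in HM by apply Cmod_ge_0.
  assert (P := pow_lt r k Hr).
  rewrite <- RtoC_pow, Cmod_div, Cmod_R, Rabs_pos_eq in HM;
    [|lra|intro Z; apply RtoC_inj in Z; lra].
  apply Rmult_le_reg_r with (/ r ^ k); [now apply Rinv_0_lt_compat|].
  rewrite Rmult_assoc, Rinv_r by lra. rewrite Rmult_1_r. exact HM.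
Qed.

Lemma Cgeometric_le (M N rho : R) (a : nat -> C) : M <= N -> Cgeometric M rho a -> Cgeometric N rho a.
Proof.
  intros HM [Hr Ha]. split; [exact Hr|]. intro k. eapply Rle_trans; [apply Ha|].
  apply Rmult_le_compat_r; [|exact HM]. apply pow_le. lra.
Qed.

Theorem lemma1 (r1 : R) (A B : nat -> C)
  (hr1 : 0 < r1)
  (hA_abs : Cseries_cv_abs_on (fun r => r1 <= r) (fun j r => (A j / RtoC r ^ j)%C))
  (hA_unif : Cseries_cv_unif_on (fun r => r1 <= r) (fun j r => (A j / RtoC r ^ j)%C))
  (hB_abs : Cseries_cv_abs_on (fun r => r1 <= r) (fun j r => (B j / RtoC r ^ j)%C))
  (hB_unif : Cseries_cv_unif_on (fun r => r1 <= r) (fun j r => (B j / RtoC r ^ j)%C))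
  (hsum : forall r : R, r1 <= r ->
    (hankel1 0 r * CSeries (fun j => A j / RtoC r ^ j)
     + hankel1 1 r * CSeries (fun j => B j / RtoC r ^ j))%C = RtoC 0) :
  forall j : nat, A j = RtoC 0 /\ B j = RtoC 0.
Proof.
  intro j.
  destruct (Cgeometric_of_cv A r1 hr1 (hA_abs r1 (Rle_refl r1))) as [M HA].
  destruct (Cgeometric_of_cv B r1 hr1 (hB_abs r1 (Rle_refl r1))) as [N HB].
  apply (hankel1_combination_zero j A B (Rmax M N) r1).
  - exact (Cgeometric_le _ _ _ _ (Rmax_l M N) HA).
  - exact (Cgeometric_le _ _ _ _ (Rmax_r M N) HB).
  - intros r Hr. rewrite <- !CSeries_div_pow by lra. apply hsum. lra.
Qed.
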